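(* Let $n$ and $\delta$ be positive integers, write $\delta=(1-\beta)n$ with $0<\beta<1$, and let $p=\lceil\beta^{-1}\rceil-1$. Let $G$ be a $K_{p+2}$-free graph of order $n$ with minimum degree $\delta$. Then $k_r(G)\ge g_r(\beta)n^r$ for every positive integer $r$. Moreover, for $3\le r\le p+1$, equality $k_r(G)=g_r(\beta)n^r$ holds if and only if $(n,\beta)$ is feasible and $G\in\mathcal{G}(n,\beta)$.
   Context: All graphs are finite and simple; $k_r(G)$ is the number of $r$-cliques of $G$. Throughout, $\delta=(1-\beta)n$ with $0<\beta<1$, and $p=\lceil \beta^{-1}\rceil-1$, so $1/(p+1)\le \beta<1/p$. For such $\beta$ and integers $r$, define $$g_r(\beta)=\binom{p-1}{r}\beta^{r}+\binom{p-1}{r-1}(1-(p-1)\beta)\beta^{r-1}+\frac12\binom{p-1}{r-2}(1-p\beta)(1-(p-1)\beta)\beta^{r-2},$$ where $p=\lceil\beta^{-1}\rceil-1$ and $\binom{x}{y}=0$ if $x<y$ or $y<0$. The family $\mathcal{G}(n,\beta)$ (defined only when $n$ and $(1-\beta)n$ are positive integers not both odd, $0<\beta<1$) consists of all graphs $G$ on vertex set $V$ with $|V|=n$ for which there is a partition $V=V_0\cup V_1\cup\dots\cup V_{p-1}$ with $|V_0|=(1-(p-1)\beta)n$ and $|V_i|=\beta n$ for $1\le i\le p-1$, such that: for $0\le i<j\le p-1$ every vertex of $V_i$ is adjacent to every vertex of $V_j$; for $1\le i\le p-1$, $V_i$ is an independent set; and $G[V_0]$ is a $(1-p\beta)n$-regular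 graph whose number of triangles is minimum among all $(1-p\beta)n$-regular graphs on $|V_0|$ vertices. The pair $(n,\beta)$ is called feasible if $\mathcal{G}(n,\beta)$ is defined and $G[V_0]$ is triangle-free for $G\in\mathcal{G}(n,\beta)$. *)

(* Defs.v *)
From HB Require Import structures.
From mathcomp Require Import all_boot all_order all_algebra.
Set Implicit Arguments. Unset Strict Implicit. Unset Printing Implicit Defensive.
Import Order.TTheory GRing.Theory Num.Theory.

Definition simple_graph (T : finType) (e : rel T) : Prop :=
  symmetric e /\ irreflexive e.

Definition deg (T : finType) (e : rel T) (x : T) : nat := #|[set y | e x y]|.

Definition deg_in (T : finType) (e : rel T) (A : {set T}) (x : T) : nat :=
  #|[set y in A | e x y]|.

Definition min_degree (T : finType) (e : rel T) (d : nat) : Prop :=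
  (forall x, d <= deg e x)%N /\ (exists x, deg e x = d).

Definition is_clique (T : finType) (e : rel T) (S : {set T}) : bool :=
  [forall x in S, forall y in S, (x != y) ==> e x y].

Definition kcl_in (T : finType) (e : rel T) (A : {set T}) (r : nat) : nat :=
  #|[set S : {set T} | [&& S \subset A, #|S| == r & is_clique e S]]|.

Definition kcl (T : finType) (e : rel T) (r : nat) : nat := kcl_in e setT r.

Local Open Scope ring_scope.

Definition beta_of (n delta : nat) : rat := 1 - delta%:R / n%:R.

Definition p_of (beta : rat) : nat := `|Num.ceil (beta^-1) - 1|%N.

Definition binz (a : nat) (b : int) : rat :=
  if (b < 0)%R then 0 else ('C(a, `|b|%N))%:R.

Definition g_fun (beta : rat) (r : nat) : rat :=
  let p := p_of beta in
  binz p.-1 r%:Z * beta ^+ r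
  + binz p.-1 (r%:Z - 1) * (1 - (p%:R - 1) * beta) * beta ^ (r%:Z - 1)
  + 2^-1 * binz p.-1 (r%:Z - 2) * (1 - p%:R * beta) * (1 - (p%:R - 1) * beta)
      * beta ^ (r%:Z - 2).

Definition family_defined (n delta : nat) : Prop :=
  [/\ (0 < n)%N, (0 < delta)%N, ~~ (odd n && odd delta),
      0 < beta_of n delta & beta_of n delta < 1].

(* f assigns each vertex its part index; V_0 = f^{-1}(0), V_i for 1 <= i <= p-1.
   This encodes the structural requirements of G(n,beta) on the partition. *)
Definition family_partition (n delta : nat) (T : finType) (e : rel T)
    (f : T -> 'I_(p_of (beta_of n delta))) : Prop :=
  let beta := beta_of n delta in
  let p := p_of beta in
  let V0 := [set x | val (f x) == 0%N] in
  [/\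
      ((#|V0|%:R = (1 - (p%:R - 1) * beta) * n%:R :> rat)
      /\ (forall i : 'I_p, (0 < val i)%N ->
         #|[set x | f x == i]|%:R = beta * n%:R :> rat)),
      (forall x y, f x != f y -> e x y),
      (forall x y, (0 < val (f x))%N -> f x = f y -> ~~ e x y),
      (forall x, x \in V0 -> (deg_in e V0 x)%:R = (1 - p%:R * beta) * n%:R :> rat)
    &
      (forall H : rel 'I_#|V0|, simple_graph H ->
         (forall v, (deg H v)%:R = (1 - p%:R * beta) * n%:R :> rat) ->
         (kcl_in e V0 3 <= kcl H 3)%N)].

Arguments family_partition n delta {T} e f.

Definition in_family (n delta : nat) (T : finType) (e : rel T) : Prop :=
  [/\ family_defined n delta, #|T| = n, simple_graph e &
      exists f, family_partition n delta e f].

Definition feasible (n delta : nat) : Prop :=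
  family_defined n delta /\
  forall (e : rel 'I_n) f, simple_graph e -> family_partition n delta e f ->
    kcl_in e [set x | val (f x) == 0%N] 3 = 0%N.

(* Main.v *)
Require Import Defs.
From HB Require Import structures.
From mathcomp Require Import all_boot all_order all_algebra.
From mathcomp Require Import zify ring lra.
Set Implicit Arguments. Unset Strict Implicit. Unset Printing Implicit Defensive.
Import Order.TTheory GRing.Theory Num.Theory.
Local Open Scope ring_scope.

(** Write [n] for the order, [b = n - delta] and [d S] for the number of common
    neighbours of a clique [S]. Since the graph is [K_{p+2}]-free, an [s]-clique
    satisfies [n - s b <= d S <= (p + 1 - s) b], so
    [(d S - (n - s b)) * ((p + 1 - s) b - d S) >= 0]. Counting, for an
    [(s+1)]-clique [A], the vertices by their number of non-neighbours in [A]
    gives [2 n + (s - 1) d A <= \sum_(v in A) d (A - v) + (s + 1) b]. Summing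
    both over all cliques yields a three-term inequality between
    [k_s], [k_{s+1}], [k_{s+2}] which [g_s n^s] satisfies with equality; downward
    induction from [k_{p+2} = 0] shows that [k_{s+1} / k_s] is at least the
    corresponding ratio for [g].

    If some [k_r] with [3 <= r <= p + 1] attains the bound, the graph is regular
    and every inequality for [s = p] is tight. In a [(p+1)]-clique [A], at least
    [p - 1] vertices [v] then have [d (A - v) = b]; their non-neighbourhoods are
    disjoint independent sets of size [b], and form the parts [V_1, ..., V_{p-1}].
    Conversely all the inequalities are tight in such a join when [V_0] is
    triangle-free. *)

(** * Cliques, common neighbours and non-neighbours *)

Definition cliques (T : finType) (e : rel T) (r : nat) : {set {set T}} :=
  [set S : {set T} | (#|S| == r) && is_clique e S].

Definition common_nbhd (T : finType) (e : rel T) (S : {set T}) : {set T} :=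
  [set x | [forall y in S, e y x]].

(* Contains [v] itself when [e] is irreflexive. *)
Definition non_nbhd (T : finType) (e : rel T) (v : T) : {set T} :=
  [set x | ~~ e v x].

Lemma is_cliqueP (T : finType) (e : rel T) (S : {set T}) :
  reflect {in S &, forall x y, x != y -> e x y} (is_clique e S).
Proof.
apply: (iffP forall_inP) => [cS x y xS yS|cS x xS].
  by have /forall_inP/(_ y yS)/implyP := cS x xS.
by apply/forall_inP => y yS; apply/implyP; apply: cS.
Qed.

Lemma kclE (T : finType) (e : rel T) (r : nat) : kcl e r = #|cliques e r|.
Proof. by apply: eq_card => S; rewrite !inE subsetT. Qed.

Lemma in_common_nbhd (T : finType) (e : rel T) (S : {set T}) (x : T) :
  (x \in common_nbhd e S) = [forall y in S, e y x].
Proof. by rewrite inE. Qed.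

Lemma common_nbhdP (T : finType) (e : rel T) (S : {set T}) (x : T) :
  reflect {in S, forall y, e y x} (x \in common_nbhd e S).
Proof. by rewrite in_common_nbhd; apply: forall_inP. Qed.

Lemma common_nbhd_notin (T : finType) (e : rel T) (S : {set T}) (x : T) :
  irreflexive e -> x \in common_nbhd e S -> x \notin S.
Proof.
by move=> irr /common_nbhdP xS; apply/negP => /xS; rewrite irr.
Qed.

Lemma common_nbhdU1 (T : finType) (e : rel T) (S : {set T}) (v : T) :
  common_nbhd e (v |: S) = common_nbhd e S :\: non_nbhd e v.
Proof.
apply/setP => x; rewrite !inE negbK; apply/forall_inP/andP => [xS|[vx xS] y].
  split; first by apply: xS; rewrite setU11.
  by apply/forall_inP => y yS; apply: xS; rewrite setU1r.
by rewrite in_setU1 => /orP[/eqP->//|]; apply: (forall_inP xS).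
Qed.

Lemma card_non_nbhd (T : finType) (e : rel T) (v : T) :
  (deg e v + #|non_nbhd e v| = #|T|)%N.
Proof.
rewrite /deg -(cardsC [set y | e v y]); congr (_ + _)%N.
by apply: eq_card => y; rewrite !inE.
Qed.

Lemma is_cliqueS (T : finType) (e : rel T) (S S' : {set T}) :
  S \subset S' -> is_clique e S' -> is_clique e S.
Proof.
move=> /subsetP sSS' /is_cliqueP cS'; apply/is_cliqueP => x y xS yS.
by apply: cS'; apply: sSS'.
Qed.

Lemma is_cliqueU1 (T : finType) (e : rel T) (S : {set T}) (v : T) :
  symmetric e -> v \notin S ->
  is_clique e (v |: S) = is_clique e S && (v \in common_nbhd e S).
Proof.
move=> sym vS; apply/idP/andP => [cS|[/is_cliqueP cS /common_nbhdP vN]].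
  split; first exact: is_cliqueS (subsetUr _ _) cS.
  apply/common_nbhdP => y yS; move/is_cliqueP: cS; apply.
  - by rewrite setU1r.
  - by rewrite setU11.
  - by apply: contraNneq vS => <-.
apply/is_cliqueP => x y; rewrite !in_setU1.
move=> /orP[/eqP->|xS] /orP[/eqP->|yS]; rewrite ?eqxx // => xy.
- by rewrite sym vN.
- exact: vN.
- exact: cS.
Qed.

Lemma cliquesU1 (T : finType) (e : rel T) (S : {set T}) (v : T) (r : nat) :
  symmetric e -> v \notin S ->
  (v |: S \in cliques e r.+1) = (S \in cliques e r) && (v \in common_nbhd e S).
Proof.
move=> sym vS; rewrite ![in LHS]inE is_cliqueU1 // cardsU1 vS.
by rewrite [S \in cliques e r]inE andbA.
Qed.

Lemma subset_of_card (T : finType) (S : {set T}) (k : nat) :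
  (k <= #|S|)%N -> exists2 U : {set T}, U \subset S & #|U| = k.
Proof.
move=> kS; exists [set:: take k (enum S)].
  by apply/subsetP => x; rewrite inE => /mem_take; rewrite mem_enum.
rewrite cardsE (card_uniqP _) ?take_uniq ?enum_uniq // size_take_min -cardE.
exact/minn_idPl.
Qed.

(** * Double counting over cliques and their subcliques *)

(** The map sending [(A, v)] to [(A :\ v, v)] is a bijection from cliques with a marked vertex onto
    smaller cliques with a marked common neighbour. *)
Lemma sum_subcliques (V : nmodType) (T : finType) (e : rel T) (r : nat)
    (F : {set T} -> V) :
  simple_graph e ->
  \sum_(A in cliques e r.+1) \sum_(v in A) F (A :\ v) =
  \sum_(S in cliques e r) F S *+ #|common_nbhd e S|.
Proof.
move=> [sym irr].
have -> : \sum_(S in cliques e r) F S *+ #|common_nbhd e S| =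
          \sum_(S in cliques e r) \sum_(v in common_nbhd e S) F S.
  by apply: eq_bigr => S _; rewrite sumr_const.
rewrite (exchange_big_dep predT) //= [RHS](exchange_big_dep predT) //=.
apply: eq_bigr => v _.
rewrite (reindex_onto (fun S => v |: S) (fun A => A :\ v)) /=; last first.
  by move=> A /andP[_ vA]; rewrite setD1K.
apply: eq_big => [S|S /andP[_ /eqP->]//].
(* Only sets avoiding [v] matter: if [v] lies in [S], both sides are false, the left because
   removing [v] does not give back [S], the right by irreflexivity. *)
rewrite setU11 andbT; have [vS|vS] := boolP (v \in S).
  rewrite [in RHS]andbC (contraTF (@common_nbhd_notin _ _ _ _ irr)) ?negbK //.
  apply/negbTE; rewrite negb_and; apply/orP; right.
  by apply: contraTneq vS => <-; rewrite setD11.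
by rewrite cliquesU1 // setU1K // eqxx andbT.
Qed.

Lemma sum_common_nbhd (T : finType) (e : rel T) (r : nat) :
  simple_graph e ->
  (\sum_(S in cliques e r) #|common_nbhd e S| = r.+1 * kcl e r.+1)%N.
Proof.
move=> gr; have := @sum_subcliques nat T e r (fun=> 1%N) gr.
under [in RHS]eq_bigr => S _ do rewrite -[_ *+ _]/(_%:R) natn.
move=> <-; rewrite kclE mulnC -sum_nat_const.
by apply: eq_bigr => A; rewrite inE => /andP[/eqP Ar _]; rewrite sum1_card.
Qed.

Lemma sum_card_exchange (I T : finType) (A : {set I}) (B : I -> {set T}) :
  (\sum_(i in A) #|B i| = \sum_x #|[set i in A | x \in B i]|)%N.
Proof.
under eq_bigr => i _ do rewrite -sum1_card.
rewrite (exchange_big_dep predT) //=; apply: eq_bigr => x _.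
by rewrite -sum1_card; apply: eq_bigl => i; rewrite !inE.
Qed.

Definition non_nbrs_in (T : finType) (e : rel T) (A : {set T}) (x : T) :=
  [set v in A | x \in non_nbhd e v].

(** * The two local inequalities and the clique defect *)

(** Let [M] be the set of non-neighbours of [x] in [A]. Then [x] is a common neighbour of [A :\ v]
    exactly when [M] is contained in [{v}], so [c] is [s + 2], 1 or 0 according to whether [m] is 0,
    1 or at least 2. *)
Lemma subclique_count (T : finType) (e : rel T) (A : {set T}) (x : T) (s : nat) :
  #|A| = s.+2 ->
  let c := #|[set v in A | x \in common_nbhd e (A :\ v)]| in
  let m := #|non_nbrs_in e A x| in
  (2 + s * (x \in common_nbhd e A) <= c + m)%N /\
  (2 + s * (x \in common_nbhd e A) == c + m)%N = (m <= 2)%N.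
Proof.
move=> As c m; rewrite /c /m; set M := non_nbrs_in e A x.
have xN (S : {set T}) : S \subset A ->
    (x \in common_nbhd e S) = (M :&: S == set0).
  move=> /subsetP sSA; apply/common_nbhdP/eqP => [xS|MS y yS].
    apply/setP => y; rewrite !inE; apply/negbTE/negP => /andP[/andP[_ nyx] yS].
    by rewrite xS in nyx.
  apply: contraT => nyx; have := in_set0 y.
  by rewrite -MS !inE nyx yS sSA.
have sMA : M \subset A by apply/subsetP => y; rewrite inE => /andP[].
have -> : [set v in A | x \in common_nbhd e (A :\ v)] =
          [set v in A | M \subset [set v]].
  apply/setP => v; rewrite !inE; case vA: (v \in A) => //=.
  rewrite -in_common_nbhd xN ?subsetDl // setIDA (setIidPl sMA).
  by rewrite setD_eq0.
rewrite xN // (setIidPl sMA).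
have [->|/set0Pn[w wM]] := eqVneq M set0.
  rewrite cards0 (_ : [set v in A | _] = A) ?As; first by split; lia.
  by apply/setP => v; rewrite inE sub0set andbT.
have [M1|M1] := eqVneq M [set w].
  rewrite M1 cards1 (_ : [set v in A | _] = [set w]) ?cards1; first by split; lia.
  apply/setP => v; rewrite !inE sub1set inE [w == v]eq_sym.
  by case: eqP => [->|_]; rewrite ?andbF // (subsetP sMA).
have M2 : (1 < #|M|)%N.
  rewrite ltnNge; apply: contra M1 => M1; rewrite eq_sym eqEcard sub1set wM.
  by rewrite cards1.
rewrite (_ : [set v in A | _] = set0) ?cards0; first by split; lia.
apply/setP => v; rewrite !inE; apply/negbTE; rewrite negb_and; apply/orP; right.
by apply/negP => /subset_leq_card; rewrite cards1 leqNgt M2.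
Qed.

(** Sum [subclique_count] over all vertices [x] and exchange the order of summation. *)
Lemma sum_subclique_nbhd (T : finType) (e : rel T) (A : {set T}) (s : nat) :
  #|A| = s.+2 ->
  let R := (\sum_(v in A) #|common_nbhd e (A :\ v)| +
           \sum_(v in A) #|non_nbhd e v|)%N in
  (2 * #|T| + s * #|common_nbhd e A| <= R)%N /\
  ((forall x, #|non_nbrs_in e A x| <= 2)%N ->
    (2 * #|T| + s * #|common_nbhd e A| = R)%N).
Proof.
move=> As R.
have eL : (2 * #|T| + s * #|common_nbhd e A| =
    \sum_x (2 + s * (x \in common_nbhd e A)))%N.
  rewrite big_split /= sum_nat_const [X in (X + _)%N]mulnC -big_distrr /=.
  by rewrite -[#|common_nbhd e A|]sum1_card [in LHS]big_mkcond.
have eR : R = (\sum_x (#|[set v in A | x \in common_nbhd e (A :\ v)]| +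
    #|non_nbrs_in e A x|))%N.
  by rewrite /R !sum_card_exchange big_split.
rewrite eL eR; split=> [|m2].
  by apply: leq_sum => x _; have [] := subclique_count e x As.
by apply: eq_bigr => x _; apply/eqP; have [_ ->] := subclique_count e x As.
Qed.

(* Total slack in the two local inequalities; with [a = n - (s+1) b] and
   [h = (p - s) b] every summand is nonnegative. *)
Definition clique_defect (T : finType) (e : rel T) (a h b : rat) (s : nat) : rat :=
  \sum_(S in cliques e s.+1)
    (#|common_nbhd e S|%:R - a) * (h - #|common_nbhd e S|%:R)
  + \sum_(A in cliques e s.+2)
    ((\sum_(v in A) #|common_nbhd e (A :\ v)|)%:R + s.+2%:R * b
      - 2 * #|T|%:R - s%:R * #|common_nbhd e A|%:R).

(** The first sum contributes the squares of the common-neighbour counts with a minus sign. By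
    [sum_subcliques] the second contributes the same squares with a plus sign, so only multiples of
    clique numbers remain. *)
Lemma clique_defectE (T : finType) (e : rel T) (a h b : rat) (s : nat) :
  simple_graph e ->
  clique_defect e a h b s =
    (s.+2%:R * (a + h + b) - 2 * #|T|%:R) * (kcl e s.+2)%:R
    - a * h * (kcl e s.+1)%:R - s%:R * s.+3%:R * (kcl e s.+3)%:R.
Proof.
move=> gr; pose d S : rat := #|common_nbhd e S|%:R.
have eS r : \sum_(S in cliques e r) d S = r.+1%:R * (kcl e r.+1)%:R.
  by rewrite -natrM -sum_common_nbhd // natr_sum.
have eA : \sum_(A in cliques e s.+2) \sum_(v in A) d (A :\ v) =
          \sum_(S in cliques e s.+1) d S ^+ 2.
  by rewrite sum_subcliques //; apply: eq_bigr => S _; rewrite -mulr_natr.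
rewrite /clique_defect.
have -> : \sum_(S in cliques e s.+1)
    (#|common_nbhd e S|%:R - a) * (h - #|common_nbhd e S|%:R) =
    (a + h) * (s.+2%:R * (kcl e s.+2)%:R) - a * h * (kcl e s.+1)%:R
    - \sum_(S in cliques e s.+1) d S ^+ 2.
  rewrite -eS kclE -sum1_card natr_sum !mulr_sumr -!sumrB.
  by apply: eq_bigr => S _; rewrite /d; ring.
rewrite -eA.
have -> : \sum_(A in cliques e s.+2)
    ((\sum_(v in A) #|common_nbhd e (A :\ v)|)%:R + s.+2%:R * b
      - 2 * #|T|%:R - s%:R * #|common_nbhd e A|%:R) =
    \sum_(A in cliques e s.+2) \sum_(v in A) d (A :\ v)
    + (s.+2%:R * b - 2 * #|T|%:R) * (kcl e s.+2)%:R
    - s%:R * (s.+3%:R * (kcl e s.+3)%:R).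
  rewrite -eS kclE -sum1_card natr_sum !mulr_sumr -!big_split -sumrB /=.
  by apply: eq_bigr => S _; rewrite natr_sum /d; ring.
ring.
Qed.

Lemma card_common_nbhdU1 (T : finType) (e : rel T) (S : {set T}) (v : T) :
  (#|common_nbhd e S| <= #|common_nbhd e (v |: S)| + #|non_nbhd e v|)%N.
Proof.
rewrite common_nbhdU1 -(cardsID (non_nbhd e v) (common_nbhd e S)) addnC leq_add2l.
exact: subset_leq_card (subsetIr _ _).
Qed.

Lemma common_nbhd_ge (T : finType) (e : rel T) (b : nat) (S : {set T}) :
  (forall v, #|non_nbhd e v| <= b)%N ->
  (#|T| <= #|common_nbhd e S| + #|S| * b)%N.
Proof.
move=> eb; move Dk: #|S| => k; elim: k S Dk => [|k IH] S Dk.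
  rewrite addn0 -cardsT subset_leq_card //; apply/subsetP => x _.
  by apply/common_nbhdP => y; rewrite (cards0_eq Dk) inE.
have /card_gt0P[v vS] : (0 < #|S|)%N by rewrite Dk.
have Sk : #|S :\ v| = k by move: Dk; rewrite (cardsD1 v) vS => -[].
have := IH _ Sk; have := card_common_nbhdU1 e (S :\ v) v; rewrite setD1K //.
have := eb v; lia.
Qed.

(* A clique of size s can be extended greedily, each new vertex removing at most
   b common neighbours, and the process stops before size p+2. *)
Lemma common_nbhd_le (T : finType) (e : rel T) (b p k : nat) (S : {set T}) :
  simple_graph e -> (forall v, #|non_nbhd e v| <= b)%N ->
  kcl e p.+2 = 0%N -> is_clique e S -> (#|S| + k = p.+1)%N ->
  (#|common_nbhd e S| <= k * b)%N.
Proof.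
move=> [sym irr] eb /eqP; rewrite kclE cards_eq0 => /eqP Kp.
elim: k S => [|k IH] S cS Sk.
  rewrite leqn0 cards_eq0; apply: contraT => /set0Pn[x xS].
  have xnS := common_nbhd_notin irr xS.
  have : x |: S \in cliques e p.+2.
    by rewrite cliquesU1 // xS inE cS -Sk addn0 eqxx.
  by rewrite Kp inE.
have [->|/set0Pn[x xS]] := eqVneq (common_nbhd e S) set0; first by rewrite cards0.
have xnS := common_nbhd_notin irr xS.
have cxS : is_clique e (x |: S) by rewrite is_cliqueU1 // cS.
have := IH _ cxS; rewrite cardsU1 xnS -Sk => /(_ ltac:(lia)).
have := card_common_nbhdU1 e S x; have := eb x; lia.
Qed.

Section Defect.

Variables (T : finType) (e : rel T) (b p s : nat).
Hypotheses (gr : simple_graph e) (eb : forall v, (#|non_nbhd e v| <= b)%N).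
Hypotheses (Kp : kcl e p.+2 = 0%N) (sp : (s <= p)%N).

Let a : rat := #|T|%:R - s.+1%:R * b%:R.
Let h : rat := (p%:R - s%:R) * b%:R.

Lemma defect_nbhd_ge0 (S : {set T}) : S \in cliques e s.+1 ->
  0 <= (#|common_nbhd e S|%:R - a) * (h - #|common_nbhd e S|%:R).
Proof.
rewrite inE => /andP[/eqP Ss cS].
have := common_nbhd_ge S eb; have := common_nbhd_le gr eb Kp cS.
rewrite Ss => /(_ (p - s)%N) -/(_ ltac:(lia)).
rewrite -2!(ler_nat rat) natrD !natrM natrB // => dh da.
by apply: mulr_ge0; rewrite /a /h; lra.
Qed.

Lemma defect_clique_ge0 (A : {set T}) : A \in cliques e s.+2 ->
  0 <= (\sum_(v in A) #|common_nbhd e (A :\ v)|)%:R + s.+2%:R * b%:R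
      - 2 * #|T|%:R - s%:R * #|common_nbhd e A|%:R :> rat.
Proof.
rewrite inE => /andP[/eqP As cA].
have [ineq _] := sum_subclique_nbhd e As.
have : (\sum_(v in A) #|non_nbhd e v| <= s.+2 * b)%N.
  by rewrite -As -sum_nat_const leq_sum.
move: ineq; rewrite -2!(ler_nat rat) !natrD !natrM; lra.
Qed.

Lemma clique_defect_ge0 : 0 <= clique_defect e a h b%:R s.
Proof.
apply: addr_ge0; apply: sumr_ge0 => A; first exact: defect_nbhd_ge0.
exact: defect_clique_ge0.
Qed.

Lemma clique_defect_eq0 : clique_defect e a h b%:R s = 0 ->
  forall S, S \in cliques e s.+1 ->
  #|common_nbhd e S|%:R = a \/ #|common_nbhd e S|%:R = h.
Proof.
move=> /eqP; rewrite paddr_eq0; last 2 first.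
- by apply: sumr_ge0 => A; exact: defect_nbhd_ge0.
- by apply: sumr_ge0 => A; exact: defect_clique_ge0.
move=> /andP[/eqP/(psumr_eq0P defect_nbhd_ge0) S0 _] S /S0 /eqP.
rewrite mulf_eq0 !subr_eq0 => /orP[/eqP|/eqP]; by [left|right].
Qed.

Lemma clique_defect_eq0_sum : clique_defect e a h b%:R s = 0 ->
  forall A, A \in cliques e s.+2 ->
  (\sum_(v in A) #|common_nbhd e (A :\ v)| + s.+2 * b =
     2 * #|T| + s * #|common_nbhd e A|)%N.
Proof.
move=> /eqP; rewrite paddr_eq0; last 2 first.
- by apply: sumr_ge0 => A; exact: defect_nbhd_ge0.
- by apply: sumr_ge0 => A; exact: defect_clique_ge0.
move=> /andP[_ /eqP/(psumr_eq0P defect_clique_ge0) A0] A /A0 A00.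
apply/eqP; rewrite -(eqr_nat rat) !natrD !natrM; apply/eqP; lra.
Qed.

End Defect.

(** * The values of the lower bound and their recursion *)

(* With [q = p - 1], [b = beta n] and [c = |V_0|], this is [g_{j+2}(beta) n^{j+2}]. *)
Definition gpart (q : nat) (c b : rat) (j : nat) : rat :=
  'C(q, j.+2)%:R * b ^+ j.+2 + c * 'C(q, j.+1)%:R * b ^+ j.+1
  + 2^-1 * c * (c - b) * 'C(q, j)%:R * b ^+ j.

(** No bound on [j] is assumed: for [j = q] the factor vanishes, and for [j > q] both binomials
    do. *)
Lemma natr_binS (q j : nat) :
  'C(q, j.+1)%:R = (q%:R - j%:R) / j.+1%:R * 'C(q, j)%:R :> rat.
Proof.
have j0 : j.+1%:R != 0 :> rat by rewrite pnatr_eq0.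
apply: (mulfI j0); rewrite mulrA [_ / _]mulrC mulrA mulfV // mul1r -natrM.
rewrite mul_bin_left natrM; have [jq|qj] := leqP j q; first by rewrite natrB.
by rewrite bin_small // !mulr0.
Qed.

(** This is [clique_defectE] at [s = j + 1] with zero defect and [gpart] in place of the clique
    numbers. By [natr_binS] every term is a rational multiple of ['C(q, j) * b ^+ j], which leaves a
    field identity. *)
Lemma gpart_rec (q j : nat) (c b : rat) :
  let n := c + q%:R * b in
  let a := n - j.+2%:R * b in
  let h := (q%:R - j%:R) * b in
  (j.+3%:R * (a + h + b) - 2 * n) * gpart q c b j.+1 =
  a * h * gpart q c b j + j.+1%:R * j.+4%:R * gpart q c b j.+2.
Proof.
rewrite /gpart !natr_binS -!natr1 !exprS.
set k : rat := j%:R; set Q : rat := q%:R; set B : rat := _%:R; set bj := b ^+ j.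
have k0 : 0 <= k by exact: ler0n.
field; rewrite !lt0r_neq0 //; lra.
Qed.

Lemma gpart_gt0 (q j : nat) (c b : rat) :
  0 < b -> b < c -> (j <= q)%N -> 0 < gpart q c b j.
Proof.
move=> b0 bc jq; rewrite /gpart.
apply: ltr_wpDl.
  have c0 : 0 <= c by lra.
  have b0' := ltW b0.
  have bX i : 0 <= b ^+ i by exact: exprn_ge0.
  by apply: addr_ge0; repeat apply: mulr_ge0 => //; exact: bX.
by rewrite !mulr_gt0 ?exprn_gt0 ?ltr0n ?bin_gt0 //; lra.
Qed.

Lemma gpart_small (q j : nat) (c b : rat) : (q < j)%N -> gpart q c b j = 0.
Proof. by move=> qj; rewrite /gpart !bin_small; [ring|lia|lia|lia]. Qed.

(** With [n = c + q b], this is the number of edges of an [(n - b)]-regular graph of order [n]. *)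
Lemma gpart0 (q : nat) (c b : rat) :
  gpart q c b 0 = (c + q%:R * b) * (c + q%:R * b - b) / 2.
Proof. rewrite /gpart !natr_binS bin0 expr1 expr0; by field. Qed.

(** * Comparing a sequence with a solution of a three-term recursion *)

Section ThreeTermRecursion.

Variables (F : realFieldType) (q : nat) (A M P x g : nat -> F).
Hypotheses (M_gt0 : forall j, (j < q)%N -> 0 < M j).
Hypotheses (P_gt0 : forall j, (j < q)%N -> 0 < P j).
Hypotheses (g_gt0 : forall j, (j <= q)%N -> 0 < g j).
Hypotheses (g_last : g q.+1 = 0) (x_last : x q.+1 = 0).
Hypothesis g_rec :
  forall j, (j < q)%N -> A j * g j.+1 = M j * g j + P j * g j.+2.

(** [D] measures how far [x] is from satisfying the recursion of [g]. Nonnegativity of [E j] says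
    that the ratio of consecutive terms at [j] is at least as large for [x] as for [g]. *)
Let D j := A j * x j.+1 - M j * x j - P j * x j.+2.
Let E j := x j.+1 * g j - g j.+1 * x j.

(** Cross-multiplying the relations for [x] and [g] eliminates the coefficient [A j], whose sign is
    therefore irrelevant. *)
Let E_rec j : (j < q)%N -> M j * E j = g j.+1 * D j + P j * E j.+1.
Proof.
move=> jq; have -> : M j * E j = x j.+1 * (M j * g j) - M j * g j.+1 * x j.
  by rewrite /E; ring.
rewrite (_ : M j * g j = A j * g j.+1 - P j * g j.+2); last first.
  by rewrite g_rec // addrK.
rewrite /E /D; ring.
Qed.

Let E_last : E q = 0.
Proof. by rewrite /E g_last x_last !mul0r subrr. Qed.

Section NonnegativeDefect.

Hypothesis D_ge0 : forall j, (j < q)%N -> 0 <= D j.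

(** Downward induction from [E q = 0], since [E_rec] writes a positive multiple of [E j] as a sum of
    nonnegative terms. *)
Let E_ge0 j : (j <= q)%N -> 0 <= E j.
Proof.
move=> jq; have [k] : {k | (q = j + k)%N} by exists (q - j)%N; lia.
elim: k j jq => [|k IH] j jq qE.
  by rewrite (_ : j = q) ?E_last //; lia.
have jltq : (j < q)%N by lia.
rewrite -(pmulr_rge0 _ (M_gt0 jltq)) E_rec //.
apply: addr_ge0; apply: mulr_ge0.
- exact: ltW (g_gt0 _).
- exact: D_ge0.
- exact: ltW (P_gt0 _).
- by apply: IH; lia.
Qed.

Lemma rec_step j : (j <= q)%N -> g j.+1 * x j <= x j.+1 * g j.
Proof. by move=> jq; rewrite -subr_ge0 E_ge0. Qed.

Lemma rec_ge j : g 0%N <= x 0%N -> (j <= q)%N -> g j <= x j.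
Proof.
move=> gx0; elim: j => [//|j IH] jq.
have jq' : (j <= q)%N by exact: ltnW.
rewrite -(ler_pM2r (g_gt0 jq')); apply: le_trans (rec_step jq').
by rewrite ler_pM2l ?IH // g_gt0.
Qed.

(** Equality at [j] descends through [rec_step] to the indices 1 and 0, so [E 0 = 0]. Going up
    again, [E_rec] writes zero as a sum of two nonnegative terms, so [D i] and [E i.+1] vanish in
    turn. *)
Lemma rec_eq j : g 0%N <= x 0%N -> (0 < j <= q)%N -> x j = g j ->
  x 0%N = g 0%N /\ forall i, (i < q)%N -> D i = 0.
Proof.
move=> gx0; elim: j => [//|j IH] jq xgj.
have jq' : (j < q)%N by lia.
have xj : x j = g j.
  apply/eqP; rewrite eq_le rec_ge ?(ltnW jq') // andbT.
  rewrite -(ler_pM2l (g_gt0 jq')).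
  by apply: le_trans (rec_step (ltnW jq')) _; rewrite xgj.
case: j => [|j] in jq xgj jq' xj IH *; last by apply: IH => //; lia.
split=> // i iq; have E0 : E 0%N = 0 by rewrite /E xgj xj subrr.
suff Ei k : (k <= q)%N -> E k = 0.
  have := E_rec iq; rewrite !Ei ?mulr0 ?addr0 ?(ltnW iq) //.
  by move=> /esym/eqP; rewrite mulf_eq0 gt_eqF ?g_gt0 //= => /eqP.
elim: k => [//|k IHk] kq.
have := E_rec kq; rewrite IHk ?(ltnW kq) // mulr0 => /esym/eqP.
rewrite paddr_eq0 ?mulr_ge0 ?D_ge0 ?E_ge0 ?(ltW (g_gt0 _)) ?(ltW (P_gt0 _)) //.
by rewrite [X in _ && X]mulf_eq0 [P k == 0]gt_eqF ?P_gt0 //= => /andP[_ /eqP].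
Qed.

End NonnegativeDefect.

(** With zero defects, [E_rec] carries [E q = 0] down to every index, so [x] and [g] have equal
    ratios and equal initial terms. *)
Lemma rec_unique j : (forall i, (i < q)%N -> D i = 0) ->
  x 0%N = g 0%N -> (j <= q)%N -> x j = g j.
Proof.
move=> D0 x0; elim: j => [//|j IH] jq.
suff : E j = 0.
  move/eqP; rewrite /E IH ?(ltnW jq) // -mulrBl mulf_eq0 subr_eq0.
  by rewrite [g j == 0]gt_eqF ?g_gt0 ?(ltnW jq) // orbF => /eqP.
have [k] : {k | (q = j + k)%N} by exists (q - j)%N; lia.
elim: k j {IH} jq => [|k IH] j jq qE; first by lia.
have := E_rec jq; rewrite D0 // mulr0 add0r.
have -> : E j.+1 = 0.
  case: (leqP q j.+1) => jq1; last by apply: IH => //; lia.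
  by rewrite (_ : j.+1 = q) ?E_last //; lia.
by rewrite mulr0 => /eqP; rewrite mulf_eq0 gt_eqF ?M_gt0 //= => /eqP.
Qed.

End ThreeTermRecursion.

(** * Rewriting [p_of] and [g_fun]; cliques of size one and two *)

Lemma p_ofP (beta : rat) : 0 < beta -> beta < 1 ->
  [/\ (0 < p_of beta)%N, (p_of beta)%:R * beta < 1
    & 1 <= ((p_of beta).+1)%:R * beta].
Proof.
move=> b0 b1; rewrite /p_of; set c := Num.ceil _.
have /andP[cl cr] : (c - 1)%:~R < beta^-1 <= c%:~R := ceil_itv _.
have bi1 : 1 < beta^-1 by rewrite invf_gt1.
have c1 : 1 < c.
  by rewrite -(ltr_int rat); apply: lt_le_trans cr.
have pE : `|c - 1|%N%:R = (c - 1)%:~R :> rat.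
  by rewrite natr_absz ger0_norm //; lia.
have bb : beta^-1 * beta = 1 by rewrite mulVf ?gt_eqF.
split.
- lia.
- by rewrite pE -[ltRHS]bb ltr_pM2r.
- rewrite -addn1 natrD pE -[leLHS]bb ler_pM2r //.
  by rewrite intrD; lra.
Qed.

Lemma binz_nat (a k : nat) : binz a k%:Z = 'C(a, k)%:R.
Proof. by []. Qed.

Lemma g_fun1 (beta : rat) : (0 < p_of beta)%N -> g_fun beta 1 = 1.
Proof.
move=> p0; rewrite /g_fun binz_nat bin1 subrr binz_nat bin0 !expr1.
(* The last binomial has lower index -1 and is zero by convention. *)
rewrite (_ : binz _ (1 - 2) = 0) // expr0z -subn1 natrB //; ring.
Qed.

Lemma g_funSS (beta n : rat) (j : nat) : (0 < p_of beta)%N ->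
  let q := (p_of beta).-1 in
  g_fun beta j.+2 * n ^+ j.+2 =
  gpart q (n - q%:R * (beta * n)) (beta * n) j.
Proof.
move=> p0 q; rewrite /g_fun /gpart -/q.
have -> : j.+2%:Z - 1 = j.+1%:Z by lia.
have -> : j.+2%:Z - 2 = j%:Z by lia.
have -> : (p_of beta)%:R = q%:R + 1 :> rat by rewrite natr1 prednK.
by rewrite !binz_nat -!exprnP !exprMn !exprS; ring.
Qed.

Lemma common_nbhd1 (T : finType) (e : rel T) (x : T) :
  #|common_nbhd e [set x]| = deg e x.
Proof.
apply: eq_card => y; rewrite [RHS]inE; apply/common_nbhdP/idP => [|xy z].
  by apply; rewrite inE.
by rewrite inE => /eqP->.
Qed.

Lemma cliques1 (T : finType) (e : rel T) : cliques e 1 = [set [set x] | x in T].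
Proof.
apply/setP => S; rewrite inE; apply/andP/imsetP => [[/cards1P[x ->] _]|[x _ ->]].
  by exists x.
rewrite cards1; split=> //; apply/is_cliqueP => y z; rewrite !inE.
by move=> /eqP-> /eqP->; rewrite eqxx.
Qed.

Lemma kcl1 (T : finType) (e : rel T) : kcl e 1 = #|T|.
Proof. by rewrite kclE cliques1 card_imset //; apply: set1_inj. Qed.

Lemma handshake (T : finType) (e : rel T) :
  simple_graph e -> (\sum_x deg e x = 2 * kcl e 2)%N.
Proof.
move=> gr; rewrite -sum_common_nbhd // cliques1 big_imset /=; last first.
  by move=> x y _ _; apply: set1_inj.
by apply: eq_bigr => x _; rewrite common_nbhd1.
Qed.

(** * The lower bound on clique numbers and its equality case *)

Section CliqueCount.

Variables (T : finType) (e : rel T) (b q : nat).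
Hypotheses (gr : simple_graph e) (b_gt0 : (0 < b)%N).
Hypotheses (eb : forall v, (#|non_nbhd e v| <= b)%N).
Hypotheses (n_gt : (q.+1 * b < #|T|)%N) (Kq : kcl e q.+3 = 0%N).

Let n : rat := #|T|%:R.
Let B : rat := b%:R.
Let G := gpart q (n - q%:R * B) B.
Let defect s : rat :=
  clique_defect e (n - s.+1%:R * B) ((q.+1%:R - s%:R) * B) B s.

(** Coefficients of [clique_defectE] at [s = j + 1]. The recursion index is the clique size minus
    two, so that it starts with the edges. *)
Let A j := j.+3%:R * (n - j.+2%:R * B + (q%:R - j%:R) * B + B) - 2 * n.
Let M j := (n - j.+2%:R * B) * ((q%:R - j%:R) * B).
Let P j : rat := j.+1%:R * j.+4%:R.
Let x j : rat := (kcl e j.+2)%:R.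

Let defectE j : defect j.+1 = A j * x j.+1 - M j * x j - P j * x j.+2.
Proof.
rewrite /defect clique_defectE // /A /M /P /x.
have -> : q.+1%:R - j.+1%:R = q%:R - j%:R :> rat by rewrite -!natr1; ring.
by [].
Qed.

Let B_gt0 : 0 < B. Proof. by rewrite ltr0n. Qed.

Let nB : q.+1%:R * B < n. Proof. by rewrite -natrM ltr_nat. Qed.

Let M_gt0 j : (j < q)%N -> 0 < M j.
Proof.
move=> jq; apply: mulr_gt0; last by apply: mulr_gt0 => //; rewrite subr_gt0 ltr_nat.
rewrite subr_gt0; apply: le_lt_trans nB.
by rewrite ler_wpM2r ?ler_nat // ltW.
Qed.

Let P_gt0 j : (j < q)%N -> 0 < P j.
Proof. by move=> _; rewrite /P -natrM ltr0n. Qed.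

Let G_gt0 j : (j <= q)%N -> 0 < G j.
Proof. by move=> jq; apply: gpart_gt0 => //; move: nB; rewrite -natr1; lra. Qed.

Let G_last : G q.+1 = 0. Proof. exact: gpart_small. Qed.

Let x_last : x q.+1 = 0. Proof. by rewrite /x Kq. Qed.

Let G_rec j : (j < q)%N -> A j * G j.+1 = M j * G j + P j * G j.+2.
Proof.
by move=> _; have := gpart_rec q j (n - q%:R * B) B; rewrite subrK.
Qed.

Let G0 : G 0%N = n * (n - B) / 2.
Proof. by rewrite /G gpart0 subrK. Qed.

Let x0 : x 0%N = (\sum_v deg e v)%:R / 2.
Proof. by rewrite handshake // natrM /x; field. Qed.

Let deg_ge v : (#|T| - b <= deg e v)%N.
Proof. by have := card_non_nbhd e v; have := eb v; lia. Qed.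

Let bn : (b <= #|T|)%N.
Proof. by apply: leq_trans (ltnW n_gt); rewrite mulSn leq_addr. Qed.

Let sum_deg_ge : (#|T| * (#|T| - b) <= \sum_v deg e v)%N.
Proof. by rewrite -sum_nat_const leq_sum. Qed.

Let x0_ge : G 0%N <= x 0%N.
Proof.
rewrite G0 x0 ler_pM2r // /n /B -natrB // -natrM ler_nat.
exact: sum_deg_ge.
Qed.

Let defect_ge0 j : (j < q)%N -> 0 <= A j * x j.+1 - M j * x j - P j * x j.+2.
Proof. by move=> jq; rewrite -defectE; apply: (clique_defect_ge0 gr eb Kq); lia. Qed.

Lemma kcl_ge_gpart j : gpart q (n - q%:R * B) B j <= (kcl e j.+2)%:R.
Proof.
have [jq|qj] := leqP j q; last by rewrite gpart_small.
exact: (rec_ge M_gt0 P_gt0 G_gt0 G_last x_last G_rec defect_ge0).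
Qed.

Lemma kcl_eq_gpart j : (0 < j <= q)%N ->
  (kcl e j.+2)%:R = gpart q (n - q%:R * B) B j ->
  (forall v, #|non_nbhd e v| = b) /\
  (forall s, (0 < s <= q)%N -> defect s = 0).
Proof.
move=> jq /(rec_eq M_gt0 P_gt0 G_gt0 G_last x_last G_rec defect_ge0 x0_ge jq).
rewrite -/(G _) => -[xG D0]; split; last first.
  by case=> [//|s] sq; rewrite defectE D0.
(* Equality at index 0 fixes the number of edges at [n (n - b) / 2], so the degree sum attains its
   minimum and every degree is [n - b]. *)
have sdeg : (\sum_(v : T) (#|T| - b) = \sum_v deg e v)%N.
  apply/eqP; rewrite sum_nat_const -(eqr_nat rat) natrM natrB //.
  by apply/eqP; move: xG; rewrite G0 x0 -/n -/B; lra.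
move=> v; have := sdeg.
rewrite (bigD1 v) //= [in RHS](bigD1 v) //=.
have : (\sum_(i | i != v) (#|T| - b) <= \sum_(i | i != v) deg e i)%N.
  by apply: leq_sum.
set S1 := \sum_(i | _) (_ - _)%N; set S2 := \sum_(i | _) _.
have := deg_ge v; have := card_non_nbhd e v; have := bn.
move: #|T| (deg e v) #|non_nbhd e v| S1 S2 => N d m S1 S2; lia.
Qed.

Lemma kcl_eq_gpart_of_defect j : (j <= q)%N ->
  (forall v, #|non_nbhd e v| = b) ->
  (forall s, (0 < s <= q)%N -> defect s = 0) ->
  (kcl e j.+2)%:R = gpart q (n - q%:R * B) B j.
Proof.
move=> jq reg D0.
apply: (rec_unique M_gt0 G_gt0 G_last x_last G_rec) => // [i iq|].
  by rewrite -defectE D0.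
rewrite -/(G _) -/(x _) G0 x0 (eq_bigr (fun=> (#|T| - b)%N)) => [|v _].
  by rewrite sum_nat_const natrM natrB.
by have := reg v; have := card_non_nbhd e v; lia.
Qed.

End CliqueCount.

(** * From tight inequalities to the partition *)

Lemma kcl_eq0 (T : finType) (e : rel T) (r : nat) (S : {set T}) :
  kcl e r = 0%N -> is_clique e S -> #|S| != r.
Proof.
rewrite kclE => /eqP; rewrite cards_eq0 => /eqP r0 cS; apply/negP => Sr.
by have := in_set0 S; rewrite -r0 inE Sr cS.
Qed.

Lemma is_cliqueU (T : finType) (e : rel T) (U S : {set T}) :
  simple_graph e -> is_clique e U -> is_clique e S -> S \subset common_nbhd e U ->
  is_clique e (U :|: S) /\ #|U :|: S| = (#|U| + #|S|)%N.
Proof.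
move=> [sym irr] /is_cliqueP cU /is_cliqueP cS /subsetP SU.
have US u x : u \in U -> x \in S -> e u x.
  by move=> uU /SU/common_nbhdP; apply.
split.
  apply/is_cliqueP => x y /setUP[xU|xS] /setUP[yU|yS] xy.
  - exact: cU.
  - exact: US.
  - by rewrite sym US.
  - exact: cS.
rewrite -cardsUI [X in (_ = _ + X)%N](_ : _ = 0%N) ?addn0 //.
apply/eqP; rewrite cards_eq0; apply/eqP/setP => x; rewrite !inE.
by apply/negP => /andP[xU xS]; have := US _ _ xU xS; rewrite irr.
Qed.

Lemma non_nbhdxx (T : finType) (e : rel T) (x : T) :
  simple_graph e -> x \in non_nbhd e x.
Proof. by move=> [_ irr]; rewrite inE irr. Qed.

Lemma non_nbhd_sym (T : finType) (e : rel T) (x y : T) :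
  simple_graph e -> (x \in non_nbhd e y) = (y \in non_nbhd e x).
Proof. by move=> [sym _]; rewrite !inE sym. Qed.

Definition independent (T : finType) (e : rel T) (S : {set T}) : Prop :=
  {in S &, forall x y, ~~ e x y}.

(** A vertex outside the common neighbourhood of [U] lies in the non-neighbourhood of exactly one
    element of [U], and each of these has size [b]. *)
Lemma card_common_nbhd_disjoint (T : finType) (e : rel T) (b : nat) (U : {set T}) :
  (forall v, #|non_nbhd e v| = b) ->
  {in U &, forall u w, u != w -> [disjoint non_nbhd e u & non_nbhd e w]} ->
  (#|common_nbhd e U| + #|U| * b = #|T|)%N.
Proof.
move=> reg disU; have -> : (#|U| * b = \sum_(u in U) #|non_nbhd e u|)%N.
  by rewrite (eq_bigr (fun=> b)) ?sum_nat_const.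
rewrite sum_card_exchange -(cardsC (common_nbhd e U)); congr (_ + _)%N.
rewrite -sum1_card [RHS]big_mkcond; apply: eq_bigr => x _.
rewrite in_setC; case: ifPn => [|].
  rewrite in_common_nbhd => /forall_inPn[u uU ux].
  rewrite (_ : [set _ in U | _] = [set u]) ?cards1 //.
  apply/setP => w; rewrite !inE; apply/andP/eqP => [[wU wx]|->//].
  apply/eqP; apply: contraT => wu; have := disU _ _ wU uU wu.
  by rewrite -setI_eq0 => /eqP/setP/(_ x); rewrite !inE wx ux.
rewrite negbK => /common_nbhdP xU; apply/eqP; rewrite cards_eq0.
by apply/eqP/setP => u; rewrite !inE; apply/negP => /andP[/xU->].
Qed.

(** A system of representatives for the parts other than [V0]: the part of [u] is to be its
    non-neighbourhood. *)
Definition separating_clique (T : finType) (e : rel T) (U : {set T}) : Prop :=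
  [/\ is_clique e U, {in U, forall u, independent e (non_nbhd e u)}
    & {in U &, forall u w, u != w -> [disjoint non_nbhd e u & non_nbhd e w]}].

(** Here [q = p - 1]. Zero defect at [s = q] leaves two possible values, [b] and [n - p b], for the
    number of common neighbours of [A :\ v], and fixes their sum over [v] in [A]. This forces the
    value [b] at least [q] times. *)
Lemma separating_clique_exists (T : finType) (e : rel T) (b q : nat)
    (A : {set T}) :
  simple_graph e -> (forall v, #|non_nbhd e v| = b) ->
  (#|T| <= q.+2 * b)%N -> (q.+1 * b < #|T|)%N ->
  kcl e q.+3 = 0%N -> A \in cliques e q.+2 ->
  clique_defect e (#|T|%:R - q.+1%:R * b%:R) ((q.+1%:R - q%:R) * b%:R) b%:R q = 0 ->
  exists2 U : {set T}, #|U| = q & separating_clique e U.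
Proof.
move=> gr reg n_le n_gt Kq Aq D0.
have eb v : (#|non_nbhd e v| <= b)%N by rewrite reg.
have dA := clique_defect_eq0_sum gr eb Kq (leqnSn q) D0 Aq.
have dS := clique_defect_eq0 gr eb Kq (leqnSn q) D0.
move: (Aq); rewrite inE => /andP[/eqP Ac cA].
have A0 : common_nbhd e A = set0.
  apply/eqP; rewrite -cards_eq0 -leqn0.
  by have := common_nbhd_le (k := 0) gr eb Kq cA; rewrite mul0n => ->; lia.
rewrite A0 cards0 muln0 addn0 in dA.
have dS' v : v \in A -> #|common_nbhd e (A :\ v)| = b \/
    (#|common_nbhd e (A :\ v)| + q.+1 * b = #|T|)%N.
  move=> vA; have : A :\ v \in cliques e q.+1.
    rewrite inE (is_cliqueS (subsetDl _ _) cA) andbT.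
    by move: Ac; rewrite (cardsD1 v) vA add1n => -[->].
  move=> /dS[] dv; [right|left]; apply/eqP; rewrite -(eqr_nat rat).
    by rewrite natrD natrM dv subrK.
  by rewrite dv -natr1 [_ + 1]addrC addrK mul1r.
pose W := [set v in A | #|common_nbhd e (A :\ v)| == b].
have qW : (q <= #|W|)%N.
  (* If [n = (q + 2) b], the two possible values coincide and [W] is all of [A]. *)
  have [nE|nE] := eqVneq #|T| (q.+2 * b)%N.
    suff -> : W = A by rewrite Ac; lia.
    apply/setP => v; rewrite inE; case vA: (v \in A) => //=.
    by have [->|] := dS' v vA; rewrite ?eqxx // nE => dv; apply/eqP; lia.
  have sWA : W \subset A by apply/subsetP => v; rewrite inE => /andP[].
  have : (\sum_(v in A) #|common_nbhd e (A :\ v)| =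
          #|W| * b + #|A :\: W| * (#|T| - q.+1 * b))%N.
    rewrite (big_setID W) /= (setIidPr sWA) -!sum_nat_const; congr (_ + _)%N.
      by apply: eq_bigr => v; rewrite inE => /andP[_ /eqP].
    apply: eq_bigr => v; rewrite !inE => /andP[/negP vW vA].
    have [dv|dv] := dS' v vA; last by rewrite -dv addnK.
    by case: vW; rewrite vA dv eqxx.
  have := cardsID W A; rewrite (setIidPr sWA) Ac.
  move: dA n_le n_gt nE.
  move: #|T| #|W| #|A :\: W| (\sum_(v in A) _)%N => n w w' S.
  move=> dA n_le n_gt nE ww SE; rewrite leqNgt; apply/negP => wq.
  (* With [c = n - (q + 1) b < b] and [w] elements in [W], the sum identity reduces to
     [(w - q) (b - c) = 0], which excludes [w < q]. *)
  have [c nc] : exists c, n = (q.+1 * b + c)%N by exists (n - q.+1 * b)%N; lia.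
  have cb : (c < b)%N by lia.
  have [t tE] : exists t, q = (w + t.+1)%N by exists (q - w).-1; lia.
  move: dA; rewrite SE nc addKn; nia.
have [U UW Uq] : exists2 U : {set T}, U \subset W & #|U| = q.
  exact: subset_of_card.
have UA u : u \in U -> u \in A by move/(subsetP UW); rewrite inE => /andP[].
have UN u : u \in U -> non_nbhd e u = common_nbhd e (A :\ u).
  move=> uU; have := subsetP UW _ uU; rewrite inE => /andP[uA /eqP du].
  (* Both sets have size [b]; a common neighbour of [A :\ u] adjacent to [u] would be a common
     neighbour of [A], which has none. *)
  apply/esym/eqP; rewrite eqEcard reg du leqnn andbT.
  apply/subsetP => x xA; rewrite inE; apply/negP => ux.
  have := in_set0 x; rewrite -A0 => /negP; apply; apply/common_nbhdP => y yA.
  have [->//|yu] := eqVneq y u.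
  by move/common_nbhdP: xA; apply; rewrite in_setD1 yu.
exists U => //; split.
- apply: is_cliqueS cA; exact/subsetP.
- move=> u uU x y; rewrite UN // => xA yA; apply/negP => xy.
  (* An edge [xy] here would extend [A :\ u] to a clique of size [q + 3]. *)
  have cAu : is_clique e (A :\ u) := is_cliqueS (subsetDl _ _) cA.
  have cxy : is_clique e [set x; y].
    apply/is_cliqueP => z w; rewrite !inE.
    move=> /orP[]/eqP-> /orP[]/eqP->; rewrite ?eqxx // => _.
    by case: gr => sym _; rewrite sym.
  have sxy : [set x; y] \subset common_nbhd e (A :\ u).
    by apply/subsetP => z; rewrite in_set2 => /orP[]/eqP->.
  have [c3 e3] := is_cliqueU gr cAu cxy sxy.
  have := kcl_eq0 Kq c3; rewrite e3 cards2.
  move: Ac; rewrite (cardsD1 u) UA // add1n => -[->].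
  have -> : x != y by apply: contraTneq xy => ->; case: gr => _ ->.
  by rewrite addn2 eqxx.
- move=> u w uU wU uw; rewrite -setI_eq0; apply/eqP/setP => x.
  rewrite in_setI in_set0 UN //; apply/negP => /andP[/common_nbhdP xA].
  by rewrite inE xA // in_setD1 eq_sym uw UA.
Qed.

(** The conditions of [family_partition] except triangle minimality, with [b] for [beta n] and
    stated in naturals without subtraction. *)
Definition join_structure (T : finType) (e : rel T) (b p : nat) (f : T -> 'I_p) :=
  let V0 := [set x | val (f x) == 0%N] in
  [/\ (#|V0| + p.-1 * b = #|T|)%N,
      (forall i : 'I_p, (0 < val i)%N -> #|[set x | f x == i]| = b),
      (forall x y, f x != f y -> e x y),
      (forall x y, (0 < val (f x))%N -> f x = f y -> ~~ e x y)
    & (forall x, x \in V0 -> (deg_in e V0 x + p * b)%N = #|T|)].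

Lemma separating_clique_join (T : finType) (e : rel T) (b p : nat) (U : {set T}) :
  simple_graph e -> (forall v, #|non_nbhd e v| = b) -> (0 < p)%N ->
  separating_clique e U -> #|U| = p.-1 -> kcl e p.+2 = 0%N ->
  exists2 f : T -> 'I_p, join_structure e b f &
    kcl_in e [set x | val (f x) == 0%N] 3 = 0%N.
Proof.
move=> gr reg p0 [cU indU disU] Up Kp.
(* Vertices adjacent to all of [U] get index 0; the others get one plus the position of their
   non-neighbour in [U], unique by disjointness. *)
pose code x := if [pick u in U | x \in non_nbhd e u] is Some u
  then (index u (enum U)).+1 else 0%N.
have codeP x : (code x < p)%N.
  rewrite /code; case: pickP => [u /andP[uU _]|//].
  suff : (index u (enum U) < p.-1)%N by lia.
  by rewrite -Up cardE index_mem mem_enum.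
pose f x : 'I_p := Ordinal (codeP x).
have fU u x : u \in U -> x \in non_nbhd e u -> val (f x) = (index u (enum U)).+1.
  move=> uU xu /=; rewrite /code; case: pickP => [w /andP[wU xw]|/(_ u)]; last first.
    by rewrite uU xu.
  have [->//|uw] := eqVneq u w.
  have := disU _ _ uU wU uw; rewrite -setI_eq0 => /eqP/setP/(_ x).
  by rewrite in_setI xu xw inE.
have f0 x : (val (f x) == 0%N) = (x \in common_nbhd e U).
  apply/idP/common_nbhdP => [fx y yU|xU].
    by apply: contraLR fx => yx; rewrite (fU y) // inE.
  rewrite /= /code; case: pickP => // u /andP[uU].
  by rewrite inE xU.
have f1 x : (0 < val (f x))%N -> exists2 u, u \in U & x \in non_nbhd e u.
  rewrite lt0n f0 in_common_nbhd => /forall_inPn[u uU ux].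
  by exists u => //; rewrite inE.
have V0E : [set x | val (f x) == 0%N] = common_nbhd e U.
  by apply/setP => x; rewrite inE f0.
have indep x y : (0 < val (f x))%N -> f x = f y -> ~~ e x y.
  move=> fx fxy; have [u uU xu] := f1 x fx.
  have [w wU yw] : exists2 w, w \in U & y \in non_nbhd e w.
    by apply: f1; rewrite -fxy.
  have := fU _ _ uU xu; rewrite fxy (fU _ _ wU yw) => -[] /(congr1 (nth u (enum U))).
  by rewrite !nth_index ?mem_enum // => wu; rewrite wu in yw; apply: (indU u).
(* Independence puts the part of [u] inside the non-neighbourhood of each of its vertices, and the
   sizes agree. Hence all non-neighbours of a vertex share its part. *)
have clsE u x : u \in U -> x \in non_nbhd e u -> non_nbhd e x = non_nbhd e u.
  move=> uU xu; apply/esym/eqP; rewrite eqEcard !reg leqnn andbT.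
  by apply/subsetP => y yu; rewrite inE; apply: (indU u).
have adj x y : f x != f y -> e x y.
  apply: contraR => nxy; have yx : y \in non_nbhd e x by rewrite inE.
  have xy : x \in non_nbhd e y by rewrite non_nbhd_sym.
  apply/eqP/val_inj.
  case: (posnP (val (f x))) => [fx0|/f1[u uU xu]]; last first.
    by rewrite (fU u x) // (fU u y) // -(clsE u x).
  case: (posnP (val (f y))) => [->//|/f1[u uU yu]].
  by rewrite (fU u x) // ?(fU u y) // -(clsE u y).
have cV0 : (#|common_nbhd e U| + p.-1 * b = #|T|)%N.
  by rewrite -Up; apply: card_common_nbhd_disjoint.
(* A triangle in [V0] together with [U] would be a clique of size [(p - 1) + 3 = p + 2]. *)
have tri : kcl_in e (common_nbhd e U) 3 = 0%N.
  apply/eqP; rewrite cards_eq0; apply/eqP/setP => S; rewrite [RHS]inE.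
  apply/negP; rewrite inE => /and3P[sS /eqP S3 cS].
  have [c3 e3] := is_cliqueU gr cU cS sS.
  by have := kcl_eq0 Kp c3; rewrite e3 Up S3 => /eqP; lia.
exists f; rewrite ?V0E //; split; rewrite ?V0E //.
- move=> i; rewrite -[val i]/(nat_of_ord i) => i0;
  have iU : (i.-1 < #|U|)%N by rewrite Up; have := ltn_ord i; lia.
  (* [u0] only serves as the default of [nth]; parts are numbered from 1 but positions from 0, hence
     [i.-1]. *)
  have [u0 _] : exists u0, u0 \in U by apply/card_gt0P; lia.
  pose u := nth u0 (enum U) i.-1.
  have iu : index u (enum U) = i.-1 by rewrite index_uniq ?enum_uniq // -cardE.
  have uU : u \in U by rewrite -mem_enum mem_nth // -cardE.
  rewrite -(reg u); apply: eq_card => x; rewrite inE.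
  have fu : val (f u) = i by rewrite (fU u) ?non_nbhdxx // iu; lia.
  apply/eqP/idP => [fx|xu]; last first.
    by apply/val_inj; rewrite (fU u) // iu; rewrite prednK.
  by rewrite inE indep ?fu //; apply/val_inj; rewrite fx fu.
- move=> x xV0.
  have xf : f x = 0%N :> nat by apply/eqP; rewrite f0.
  have : (deg e x + b = #|T|)%N by rewrite -(reg x) card_non_nbhd.
  have -> : deg e x = (deg_in e (common_nbhd e U) x + #|~: common_nbhd e U|)%N.
    rewrite /deg -(cardsID (common_nbhd e U)); congr (_ + _)%N.
      by apply: eq_card => y; rewrite ![in LHS]inE [in RHS]inE andbC -in_common_nbhd.
    apply: eq_card => y; rewrite in_setD in_setC andb_idr // -f0 => fy.
    by rewrite inE adj //; apply: contraNneq fy => <-; apply/eqP.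
  have := cardsC (common_nbhd e U); move: cV0.
  move: #|T| #|~: _| #|common_nbhd e U| (deg_in _ _ _) => n c v d.
  by case: p p0 {f1 fU f0 V0E indep clsE adj f xf codeP Kp Up tri} => // p _ /=; lia.
Qed.

(** * The converse: a join with triangle-free [V0] has zero defect *)

Section JoinStructure.

Variables (T : finType) (e : rel T) (b p : nat) (f : T -> 'I_p).
Hypotheses (gr : simple_graph e) (p_gt0 : (0 < p)%N) (fP : join_structure e b f).

Let V0 := [set x | val (f x) == 0%N].

(** All non-neighbours of [x] lie in its own part. Outside [V0] they fill it; inside [V0] their
    number is [(n - (p - 1) b) - (n - p b)]. *)
Lemma join_regular x : #|non_nbhd e x| = b.
Proof.
have [cV0 cVi adj indep dV0] := fP.
have non_f y : y \in non_nbhd e x -> f x = f y.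
  by rewrite inE => nxy; apply/eqP; apply: contraR nxy => /adj->.
case: (posnP (val (f x))) => fx; last first.
  rewrite -(cVi _ fx); apply: eq_card => y; rewrite [RHS]inE.
  apply/idP/eqP => [/non_f->//|yx]; rewrite inE.
  exact: indep.
have xV0 : x \in V0 by rewrite inE fx.
have sV0 : non_nbhd e x \subset V0.
  by apply/subsetP => y /non_f xy; rewrite inE -xy fx.
have : (#|V0| = deg_in e V0 x + #|non_nbhd e x|)%N.
  rewrite -(cardsID (non_nbhd e x) V0) (setIidPr sV0) addnC; congr (_ + _)%N.
  by apply: eq_card => y; rewrite !inE negbK andbC.
move: (dV0 x xV0) cV0; rewrite -/V0.
move: (deg_in _ _ _) #|V0| #|non_nbhd _ _| #|T| p_gt0 => d v m n p0.
case: p p0 => // r _ /=; lia.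
Qed.

Hypothesis tri : kcl_in e V0 3 = 0%N.

Lemma join_clique_V0 (S : {set T}) : is_clique e S -> (#|S :&: V0| <= 2)%N.
Proof.
move=> cS; rewrite leqNgt; apply/negP => /subset_of_card[R RS R3].
have : R \in [set S : {set T} | [&& S \subset V0, #|S| == 3 & is_clique e S]].
  rewrite inE R3 eqxx (subset_trans RS (subsetIr _ _)) /=.
  exact: is_cliqueS (subset_trans RS (subsetIl _ _)) cS.
by move/eqP: tri; rewrite cards_eq0 => /eqP->; rewrite inE.
Qed.

Lemma join_clique_inj (S : {set T}) : is_clique e S ->
  {in S &, forall u w, u != w -> f u = f w -> val (f u) = 0%N}.
Proof.
move=> /is_cliqueP cS u w uS wS uw fuw; apply/eqP; rewrite -leqn0 leqNgt.
have [_ _ _ indep _] := fP.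
by apply/negP => fu; have := indep _ _ fu fuw; rewrite cS.
Qed.

(** The non-neighbours of [x] lie in its part, which a clique meets in at most two vertices for [V0]
    and at most one otherwise. This is the equality condition of [sum_subclique_nbhd]. *)
Lemma join_non_nbrs_in (S : {set T}) x :
  is_clique e S -> (#|non_nbrs_in e S x| <= 2)%N.
Proof.
move=> cS; have [_ _ adj _ _] := fP.
have non_f v : v \in non_nbrs_in e S x -> (v \in S) /\ f v = f x.
  rewrite !inE => /andP[vS nvx]; split=> //.
  by apply/eqP; apply: contraR nvx => /adj->.
case: (posnP (val (f x))) => fx.
  apply: leq_trans (join_clique_V0 cS); apply/subset_leq_card/subsetP => v.
  by move=> /non_f[vS fv]; rewrite in_setI vS inE fv fx.
have [->|/set0Pn[v vM]] := eqVneq (non_nbrs_in e S x) set0; first by rewrite cards0.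
apply: (@leq_trans #|[set v]|); last by rewrite cards1.
apply/subset_leq_card/subsetP => w wM; rewrite inE.
have [[vS fv] [wS fw]] := (non_f v vM, non_f w wM).
apply: contraT => wv; have := join_clique_inj cS wS vS wv.
by rewrite fv fw => /(_ erefl) fx0; rewrite fx0 in fx.
Qed.

Hypothesis Kp : kcl e p.+2 = 0%N.

(** If [S] has at most one vertex in [V0], its vertices lie in distinct parts and their
    non-neighbourhoods are disjoint. Otherwise the parts that [S] misses supply enough common
    neighbours to reach the upper bound. *)
Lemma join_common_nbhd (S : {set T}) (s : nat) :
  is_clique e S -> #|S| = s.+1 -> (s < p)%N ->
  (#|common_nbhd e S| + s.+1 * b = #|T|)%N \/
  (#|common_nbhd e S| = (p - s) * b)%N.
Proof.
move=> cS Ss sp; have [_ cVi adj _ _] := fP.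
have [V2|V1] := leqP 2 #|S :&: V0|.
  right; apply/eqP; rewrite eqn_leq; apply/andP; split.
    have eb v : (#|non_nbhd e v| <= b)%N by rewrite join_regular.
    by apply: common_nbhd_le gr eb Kp cS _; rewrite Ss; lia.
  (* [I] indexes the parts other than [V0] missed by [S]. As two vertices of [S] are in [V0], at
     most [s - 1] of the other [p - 1] parts are met. *)
  pose o : 'I_p := Ordinal p_gt0.
  pose I := ~: (o |: f @: (S :\: V0)).
  have Ip : (p - s <= #|I|)%N.
    have := cardsC (o |: f @: (S :\: V0)); rewrite card_ord -/I.
    have := leq_imset_card f (S :\: V0).
    have := cardsU1 o (f @: (S :\: V0)).
    have := leq_b1 (o \notin f @: (S :\: V0)).
    have := cardsID V0 S; rewrite Ss.
    move: V2; move: #|_| #|_| #|_| #|_| #|_| (_ \notin _) => *; lia.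
  apply: (@leq_trans (\sum_(i in I) #|[set x | f x == i]|)%N).
    rewrite (eq_bigr (fun=> b)) ?sum_nat_const ?leq_mul2r ?Ip ?orbT // => i.
    rewrite !inE negb_or => /andP[io _]; apply: cVi.
    by rewrite lt0n; apply: contra io => /eqP i0; apply/eqP/val_inj.
  apply: (@leq_trans #|[set x | f x \in I]|).
    rewrite -[X in (_ <= X)%N]sum1_card (partition_big f (mem I)) /=; last first.
      by move=> x; rewrite inE.
    apply: leq_sum => i iI; rewrite -sum1_card; apply/eq_leq/eq_bigl => x.
    by rewrite !inE; case: eqP => [->|]; rewrite ?andbF // andbT;
      move: iI; rewrite !inE.
  apply/subset_leq_card/subsetP => x; rewrite inE => xI.
  apply/common_nbhdP => y yS; apply: adj; apply: contraTneq xI => <-.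
  rewrite !inE negbK; case: (boolP (y \in V0)) => yV0.
    apply/orP; left; rewrite -val_eqE /=; by rewrite inE in yV0.
  by rewrite imset_f ?orbT // inE yV0.
left; rewrite -Ss; apply: card_common_nbhd_disjoint join_regular _.
move=> u w uS wS uw; rewrite -setI_eq0; apply/eqP/setP => x.
rewrite in_set0; apply/negP => /setIP[]; rewrite !inE => nux nwx.
have fu : f u = f x by apply/eqP; apply: contraR nux => /adj->.
have fw : f w = f x by apply/eqP; apply: contraR nwx => /adj->.
have fu0 := join_clique_inj cS uS wS uw (etrans fu (esym fw)).
have : [set u; w] \subset S :&: V0.
  apply/subsetP => z; rewrite in_set2 => /orP[]/eqP->.
    by rewrite inE uS inE fu0.
  by rewrite inE wS inE fw -fu fu0.
by move/subset_leq_card; rewrite cards2 uw leqNgt V1.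
Qed.

Lemma join_defect (s : nat) : (s < p)%N ->
  clique_defect e (#|T|%:R - s.+1%:R * b%:R) ((p%:R - s%:R) * b%:R) b%:R s = 0.
Proof.
move=> sp; rewrite /clique_defect !big1 ?addr0 // => S; rewrite inE.
  move=> /andP[/eqP Ss cS]; have [_] := sum_subclique_nbhd e Ss.
  move=> /(_ (fun x => join_non_nbrs_in x cS)).
  rewrite (eq_bigr (fun=> b) (fun v _ => join_regular v)) sum_nat_const Ss.
  by move/(congr1 (fun k => k%:R : rat)); rewrite !natrD !natrM; lra.
move=> /andP[/eqP Ss cS]; have [dS|->] := join_common_nbhd cS Ss sp.
  by rewrite -dS natrD natrM addrK subrr mul0r.
by rewrite natrM natrB ?(ltnW sp) // subrr mulr0.
Qed.

End JoinStructure.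

(** * Transport of graphs along injections *)

Section Pullback.

Variables (S T : finType) (g : S -> T) (e : rel T).
Hypothesis g_inj : injective g.

Lemma simple_graph_relpre : simple_graph e -> simple_graph (relpre g e).
Proof. by move=> [sym irr]; split=> [x y|x] /=; [exact: sym|exact: irr]. Qed.

Lemma is_clique_relpre (A : {set S}) :
  is_clique (relpre g e) A = is_clique e (g @: A).
Proof.
apply/is_cliqueP/is_cliqueP => [cA _ _ /imsetP[x xA ->] /imsetP[y yA ->]|].
  by rewrite (inj_eq g_inj); apply: cA.
by move=> cA x y xA yA xy; apply: cA; rewrite ?imset_f // (inj_eq g_inj).
Qed.

Lemma kcl_in_relpre (A : {set S}) r :
  kcl_in (relpre g e) A r = kcl_in e (g @: A) r.
Proof.
rewrite /kcl_in -(card_imset _ (imset_inj g_inj)); apply: eq_card => R.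
rewrite [RHS]inE; apply/imsetP/and3P => [[Q]|[RA /eqP Rr cR]].
  rewrite inE => /and3P[QA /eqP Qr cQ] ->.
  by rewrite imsetS // card_imset // Qr eqxx -is_clique_relpre.
have RE : R = g @: (g @^-1: R).
  apply/setP => y; apply/idP/imsetP => [yR|[x xR ->]]; last by rewrite inE in xR.
  have /imsetP[x _ yx] := subsetP RA _ yR.
  by exists x; rewrite // inE -yx.
exists (g @^-1: R) => //; rewrite inE is_clique_relpre -RE cR andbT.
apply/andP; split; last by rewrite -(card_imset _ g_inj) -RE Rr.
apply/subsetP => x; rewrite inE => /(subsetP RA)/imsetP[y yA].
by move/g_inj->.
Qed.

Lemma deg_in_relpre (A : {set S}) x :
  deg_in (relpre g e) A x = deg_in e (g @: A) (g x).
Proof.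
rewrite /deg_in -(card_imset _ g_inj); apply: eq_card => y.
rewrite [RHS]inE; apply/imsetP/andP => [[z]|[/imsetP[z zA ->] xz]].
  by rewrite inE => /andP[zA xz] ->; rewrite imset_f.
by exists z; rewrite // inE zA.
Qed.

End Pullback.

Lemma deg_in_setT (T : finType) (e : rel T) x : deg_in e setT x = deg e x.
Proof. by apply: eq_card => y; rewrite !inE. Qed.

(** * Membership in the family and feasibility *)

Section Family.

Variables (n delta b : nat) (T : finType) (e : rel T).
Let beta := beta_of n delta.
Let p := p_of beta.
Variable f : T -> 'I_p.
Hypotheses (p_gt0 : (0 < p)%N) (bE : beta * n%:R = b%:R) (Tn : #|T| = n).

Let V0 := [set x | val (f x) == 0%N].

Let pE : p%:R = p.-1%:R + 1 :> rat.
Proof. by rewrite natr1 prednK. Qed.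

Let V0E : (#|V0|%:R = (1 - (p%:R - 1) * beta) * n%:R :> rat) <->
  (#|V0| + p.-1 * b = #|T|)%N.
Proof.
rewrite mulrBl mul1r -mulrA bE pE addrK Tn; split=> [V0n|<-].
  by apply/eqP; rewrite -(eqr_nat rat) natrD natrM V0n subrK.
by rewrite natrD natrM addrK.
Qed.

Let degE d : (d%:R = (1 - p%:R * beta) * n%:R :> rat) <-> (d + p * b = #|T|)%N.
Proof.
rewrite mulrBl mul1r -mulrA bE Tn; split=> [dn|<-].
  by apply/eqP; rewrite -(eqr_nat rat) natrD natrM dn subrK.
by rewrite natrD natrM addrK.
Qed.

Lemma family_partition_join : family_partition n delta e f -> join_structure e b f.
Proof.
case=> -[/V0E cV0 cVi] adj indep dV0 _; split=> // [i i0|x /dV0/degE//].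
by apply/eqP; rewrite -(eqr_nat rat) cVi // bE.
Qed.

Lemma join_family_partition : join_structure e b f -> kcl_in e V0 3 = 0%N ->
  family_partition n delta e f.
Proof.
move=> [cV0 cVi adj indep dV0] tri; split=> //.
- by split=> [|i i0]; [apply/V0E|rewrite cVi].
- by move=> x /dV0/degE.
- by move=> H _ _; rewrite tri.
Qed.

(* The induced graph on [V0] competes in the minimality clause of any other
   member of the family. *)
Lemma join_triangle_free (S : finType) (e' : rel S) (f' : S -> 'I_p) :
  #|S| = n -> simple_graph e -> join_structure e b f -> kcl_in e V0 3 = 0%N ->
  family_partition n delta e' f' ->
  kcl_in e' [set x | val (f' x) == 0%N] 3 = 0%N.
Proof.
move=> Sn gr [cV0 _ _ _ dV0] tri [[cV0' _] _ _ _]; set W := [set x | _] in cV0' *.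
have WV : #|W| = #|V0|.
  by apply/eqP; rewrite -(eqr_nat rat) cV0'; apply/eqP/esym/V0E.
(* [W] and [V0] have equal size, so [g] makes the graph induced on [V0] a graph on [#|W|] points. *)
pose g (i : 'I_#|W|) : T := enum_val (cast_ord WV i).
have g_inj : injective g by move=> i j /enum_val_inj/cast_ord_inj.
have gT : g @: setT = V0.
  apply/eqP; rewrite eqEcard card_imset // cardsT card_ord (eq_leq (esym WV)) andbT.
  by apply/subsetP => _ /imsetP[i _ ->]; apply: enum_valP.
move=> /(_ (relpre g e) (simple_graph_relpre g gr)) minW.
have trig : kcl (relpre g e) 3 = 0%N by rewrite /kcl kcl_in_relpre // gT.
apply/eqP; rewrite -leqn0 -[leqRHS]trig; apply: minW => v.
rewrite -deg_in_setT deg_in_relpre // gT.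
by apply/degE/dV0; apply: enum_valP.
Qed.

End Family.

(** Feasibility concerns graphs on ['I_n], so graph and partition are pulled back along
    [enum_val]. *)
Lemma feasible_triangle_free (T : finType) (e : rel T) (delta : nat)
    (f : T -> 'I_(p_of (beta_of #|T| delta))) :
  simple_graph e -> feasible #|T| delta -> family_partition #|T| delta e f ->
  kcl_in e [set x | val (f x) == 0%N] 3 = 0%N.
Proof.
move=> gr [_ feas] [[cV0 cVi] adj indep dV0 minV0].
set V0 := [set x | _] in cV0 dV0 minV0 *.
pose g : 'I_#|T| -> T := enum_val.
have g_inj : injective g := enum_val_inj.
have g_onto (A : {set T}) : g @: (g @^-1: A) = A.
  apply/setP => x; apply/imsetP/idP => [[y yA ->]|xA]; first by rewrite inE in yA.
  by exists (enum_rank x); rewrite ?inE /g enum_rankK.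
have g_card (A : {set T}) : #|g @^-1: A| = #|A|.
  by rewrite -[in RHS](g_onto A) card_imset.
have V0E : [set x | val ((f \o g) x) == 0%N] = g @^-1: V0.
  by apply/setP => x; rewrite !inE.
have := feas (relpre g e) (f \o g) (simple_graph_relpre g gr).
rewrite V0E kcl_in_relpre // g_onto; apply; split; rewrite ?V0E ?g_card.
- split=> // i i0; rewrite -(cVi i) // -g_card; congr _%:R; apply: eq_card => x.
  by rewrite !inE.
- by move=> x y; apply: adj.
- by move=> x y; apply: indep.
- by move=> x; rewrite inE deg_in_relpre // g_onto; apply: dV0.
- by rewrite kcl_in_relpre // g_onto.
Qed.

(** * The bound and the characterisation of equality *)

Theorem mainTheorem2 (T : finType) (e : rel T) (delta : nat) :
  simple_graph e ->
  (0 < #|T|)%N -> (0 < delta)%N ->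
  0 < beta_of #|T| delta -> beta_of #|T| delta < 1 ->
  min_degree e delta ->
  kcl e (p_of (beta_of #|T| delta)).+2 = 0%N ->
  (forall r : nat, (0 < r)%N ->
     g_fun (beta_of #|T| delta) r * (#|T|%:R) ^+ r <= (kcl e r)%:R) /\
  (forall r : nat, (3 <= r <= (p_of (beta_of #|T| delta)).+1)%N ->
     ((kcl e r)%:R = g_fun (beta_of #|T| delta) r * (#|T|%:R) ^+ r
      <-> feasible #|T| delta /\ in_family #|T| delta e)).
Proof.
move=> gr n0 d0 beta0 beta1 [deg_ge _]; set n := #|T| in n0 beta0 beta1 *.
set beta := beta_of n delta in beta0 beta1 *; set p := p_of beta => Kp.
have [p0 pb pb1] := p_ofP beta0 beta1.
have nR : 0 < n%:R :> rat by rewrite ltr0n.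
have nbeta : beta * n%:R = n%:R - delta%:R.
  by rewrite /beta /beta_of mulrBl mul1r divfK ?gt_eqF.
have dn : (delta < n)%N.
  by rewrite -(ltr_nat rat) -subr_gt0 -nbeta mulr_gt0.
set b := (n - delta)%N; have b0 : (0 < b)%N by rewrite subn_gt0.
have bE : beta * n%:R = b%:R by rewrite nbeta natrB // ltnW.
have n_gt : (p * b < n)%N.
  by rewrite -(ltr_nat rat) natrM -bE mulrA -[ltRHS]mul1r ltr_pM2r.
have n_le : (n <= p.+1 * b)%N.
  by rewrite -(ler_nat rat) natrM -bE mulrA -[leLHS]mul1r ler_pM2r.
have eb v : (#|non_nbhd e v| <= b)%N.
  by have := deg_ge v; have := card_non_nbhd e v; rewrite -/n /b; lia.
have [q pq] : exists q, p = q.+1 by exists p.-1; rewrite prednK.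
have gE j : g_fun beta j.+2 * n%:R ^+ j.+2 = gpart q (n%:R - q%:R * b%:R) b%:R j.
  by rewrite g_funSS // -/p pq /= bE.
have Kq : kcl e q.+3 = 0%N by rewrite -pq.
have nq : (q.+1 * b < n)%N by rewrite -pq.
split=> [[//|[|j]] _|[|[|[|r]]] // rp].
- by rewrite g_fun1 // mul1r expr1 kcl1.
- by rewrite gE; exact: kcl_ge_gpart.
(* Clique size [r + 3] has index [r + 1], so the range from 3 to [p + 1] becomes 1 to [q]. *)
rewrite gE; have rq : (0 < r.+1 <= q)%N by rewrite pq in rp; lia.
split=> [Kr|[feas [fd _ _ [f fP]]]]; last first.
  have tri := feasible_triangle_free gr feas fP.
  have jf := family_partition_join p0 bE erefl fP.
  apply: (kcl_eq_gpart_of_defect gr b0 eb nq Kq) => [|v|s sq].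
  - by case/andP: rq.
  - exact: join_regular jf v.
  - have := join_defect gr p0 jf tri Kp (s := s).
    by rewrite -/p pq; apply; case/andP: sq.
have [reg D0] := kcl_eq_gpart gr b0 eb nq Kq rq Kr.
(* A [(p + 1)]-clique exists because the lower bound for [k_{p+1}] is positive. *)
have /set0Pn[A Aq] : cliques e q.+2 != set0.
  rewrite -card_gt0 -kclE -(ltr_nat rat).
  apply: lt_le_trans (kcl_ge_gpart gr b0 eb nq Kq q).
  apply: gpart_gt0; rewrite ?ltr0n //.
  by move: nq; rewrite -(ltr_nat rat) natrM -natr1; lra.
have [U Uq sepU] : exists2 U : {set T}, #|U| = q & separating_clique e U.
  apply: separating_clique_exists gr reg _ nq Kq Aq _; first by rewrite -pq.
  by apply: D0; rewrite leqnn andbT; lia.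
have [f fP tri] : exists2 f : T -> 'I_p, join_structure e b f &
    kcl_in e [set x | val (f x) == 0%N] 3 = 0%N.
  by apply: separating_clique_join gr reg p0 sepU _ Kp; rewrite Uq -/p pq.
(* The graph is [delta]-regular, so [n delta] is twice the number of edges. *)
have odd_nd : ~~ (odd n && odd delta).
  rewrite -oddM (_ : (n * delta = 2 * kcl e 2)%N) ?oddM //.
  rewrite -handshake // -sum_nat_const; apply: eq_bigr => v _.
  by have := card_non_nbhd e v; rewrite reg -/n /b; lia.
have fd : family_defined n delta by split.
split.
  split=> // e' f' _ fP'.
  exact: (join_triangle_free p0 bE erefl (card_ord n) gr fP tri fP').
split=> //; exists f; exact: (join_family_partition p0 bE erefl fP tri).
Qed.
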